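(* Let $G$ be a finite simple graph, let $V(G)=A\sqcup B$ be a maximum cut, and let $E_{\mathrm{def}}$ be the set of defect edges (those with both endpoints in $A$ or both in $B$), so that $|E_{\mathrm{def}}|=\mathrm{def}(G)$. Then $$\ell(\mathcal A(G))\ \le\ \sum_{uv\in E_{\mathrm{def}}}\min\bigl(d(u)-1,\,d(v)-1\bigr).$$ In particular, $$\ell(\mathcal A(G))\le(\Delta(G)-1)\,\mathrm{def}(G).$$
   Context: Here $d(v)$ is the degree of $v$ and $\Delta(G)$ the maximum degree of $G$. Fix an orientation of the edges of $G=(V,E)$; the oriented incidence matrix $D$ is the $|V|\times|E|$ matrix with $D_{ve}=+1$ if $v$ is the head of $e$, $-1$ if $v$ is the tail of $e$, and $0$ otherwise. The antisymmetric line graph $\mathcal A(G)$ is the signed graph with vertex set $E(G)$ and signed adjacency matrix $D^{\mathsf T}D-2I$ (nonzero entries are edges, with the entry $\pm1$ as sign). Switching a signed graph at a vertex reverses the signs of all edges incident to it; changing the orientation changes $\mathcal A(G)$ only by switching. The sign of a cycle is the product of its edge signs, and a signed graph is balanced if all its cycles are positive. The frustration index $\ell(\Sigma)$ of a signed graph $\Sigma$ is the minimum number of edges whose deletion makes $\Sigma$ balanced (equivalently, the minimum number of negative edges among all switchings of $\Sigma$); it is switching invariant. The Max-Cut defect is $\mathrm{def}(G)=|E(G)|-\mathrm{MaxCut}(G)$, where $\mathrm{MaxCut}(G)$ is the maximum number of edges between the two sides of a bipartition of $V(G)$; a maximum cut is a bipartition attaining it. *)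

(* Defs.v *)
From mathcomp Require Import all_boot all_order all_algebra.

Set Implicit Arguments.
Unset Strict Implicit.
Unset Printing Implicit Defensive.

Import GRing.Theory.
Local Open Scope ring_scope.

Record sgraph (V : finType) := SGraph {
  adj :> rel V;
  adj_sym : symmetric adj;
  adj_irr : irreflexive adj }.

Section Edges.
Context {V : finType}.
Variable G : sgraph V.

Definition edge_set : {set {set V}} :=
  [set [set p.1; p.2] | p : V * V & adj G p.1 p.2].

End Edges.

Notation edge G := {f : {set _} | f \in edge_set G}.

Section Graph.
Context {V : finType}.
Variable G : sgraph V.

Definition degree (v : V) : nat := #|[set w | adj G v w]|.

Definition max_degree : nat := (\max_(v : V) degree v)%N.

(* Either side may be empty. *)
Definition bipartition (A B : {set V}) : bool :=
  (A :|: B == setT) && [disjoint A & B].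

Definition cut_edges (A B : {set V}) : {set {set V}} :=
  [set f in edge_set G | [exists x in A, exists y in B, f == [set x; y]]].

Definition maxcut : nat :=
  (\max_(P : {set V} * {set V} | bipartition P.1 P.2)
     #|cut_edges P.1 P.2|)%N.

Definition maximum_cut (A B : {set V}) : Prop :=
  bipartition A B /\ #|cut_edges A B| = maxcut.

Definition defect_edges (A B : {set V}) : {set {set V}} :=
  [set f in edge_set G | (f \subset A) || (f \subset B)].

(* The subtraction never truncates: a cut consists of edges. *)
Definition maxcut_defect : nat := (#|edge_set G| - maxcut)%N.

Record orientation := Orientation {
  ehead : edge G -> V;
  etail : edge G -> V;
  orientationP : forall f : edge G, val f = [set etail f; ehead f] }.

Definition inc (o : orientation) (v : V) (f : edge G) : int :=
  if v == ehead o f then 1 else if v == etail o f then -1 else 0.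

(* Rows and columns follow the canonical enumerations of V and of E(G). *)
Definition incidence_mx (o : orientation) : 'M[int]_(#|V|, #|{: edge G}|) :=
  \matrix_(i, j) inc o (enum_val i) (enum_val j).

End Graph.

(* A signed graph on {0, .., n-1}, given by its signed adjacency matrix. *)
Record signed_graph (n : nat) := SignedGraph {
  sadj :> 'M[int]_n;
  sadj_sym : forall i j, sadj i j = sadj j i;
  sadj_diag : forall i, sadj i i = 0;
  sadj_val : forall i j, sadj i j \in [:: -1; 0; 1] }.

Section SignedGraph.
Context {n : nat}.
Implicit Type S : signed_graph n.

Program Definition underlying S : sgraph 'I_n :=
  @SGraph _ (fun i j => S i j != 0) _ _.
Next Obligation. by move=> S i j /=; rewrite sadj_sym. Qed.
Next Obligation. by move=> S i /=; rewrite sadj_diag eqxx. Qed.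

Definition signed_edges S : {set {set 'I_n}} := edge_set (underlying S).

Program Definition delete_edges S (F : {set {set 'I_n}}) : signed_graph n :=
  @SignedGraph n (\matrix_(i, j) if [set i; j] \in F then 0 else S i j) _ _ _.
Next Obligation. by move=> S F i j; rewrite !mxE setUC sadj_sym. Qed.
Next Obligation. by move=> S F i; rewrite !mxE sadj_diag if_same. Qed.
Next Obligation. by move=> S F i j; rewrite !mxE; case: ifP => // _; exact: sadj_val. Qed.

Definition is_cycle S (c : seq 'I_n) : bool :=
  [&& (2 < size c)%N, uniq c & cycle (adj (underlying S)) c].

Definition cycle_sign S (c : seq 'I_n) : int :=
  \prod_(i <- c) S i (next c i).

(* A cycle has distinct vertices, so bounding its length by n loses nothing:
   see balancedP. *)
Definition balanced S : bool :=
  [forall c : n.-bseq 'I_n, is_cycle S c ==> (cycle_sign S c == 1)].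

Lemma balancedP S :
  reflect (forall c : seq 'I_n, is_cycle S c -> cycle_sign S c = 1)
          (balanced S).
Proof.
apply: (iffP forallP) => [H c cc | H c]; last first.
  by apply/implyP => /H ->.
have szc : (size c <= n)%N.
  case/and3P: (cc) => _ uc _.
  by rewrite -[X in (_ <= X)%N](card_ord n) -(card_uniqP uc) max_card.
by have /implyP/(_ cc)/eqP := H (Bseq szc).
Qed.

Definition frustration_set S (F : {set {set 'I_n}}) : bool :=
  (F \subset signed_edges S) && balanced (delete_edges S F).

Definition frustration_index S : nat :=
  #|[arg min_(F < signed_edges S | frustration_set S F) #|F|]%N|.

Lemma frustration_set_full S : frustration_set S (signed_edges S).
Proof.
rewrite /frustration_set subxx; apply/balancedP => -[|x [|y c]] //.
case/and3P => _ _ /= /andP[+ _].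
rewrite !mxE; case: ifPn => [_|/imsetP nE Sxy]; first by rewrite eqxx.
by case: nE; exists (x, y) => //; rewrite inE.
Qed.

Lemma frustration_indexP S :
  (exists2 F, frustration_set S F & #|F| = frustration_index S) /\
  (forall F, frustration_set S F -> (frustration_index S <= #|F|)%N).
Proof.
rewrite /frustration_index; case: arg_minnP => [|F fF minF].
  exact: frustration_set_full.
by split; first by exists F.
Qed.

End SignedGraph.

Section AntisymmetricLineGraph.
Context {V : finType} {G : sgraph V}.
Variable o : orientation G.
Implicit Types f g : edge G.

Lemma card_edge f : #|val f| = 2%N.
Proof.
have /imsetP[[x y] /=] := valP f; rewrite inE /= => xy ->.
by rewrite cards2; case: eqP xy => // ->; rewrite adj_irr.
Qed.

Lemma head_neq_tail f : ehead o f != etail o f.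
Proof.
have := card_edge f; rewrite (orientationP o) cards2 eq_sym.
by case: (_ == _).
Qed.

Lemma inc_neq0 v f : (inc o v f != 0) = (v \in val f).
Proof.
rewrite (orientationP o) !inE /inc orbC.
by case: (v == ehead o f) => //; case: (v == etail o f).
Qed.

Lemma inc_sum f g :
  \sum_v inc o v f * inc o v g = inc o (ehead o f) g - inc o (etail o f) g.
Proof.
have nht := head_neq_tail f.
rewrite (bigD1 (ehead o f)) //= (bigD1 (etail o f)) /=; last by rewrite eq_sym.
rewrite big1 => [|v /andP[/negPf vh /negPf vt]]; last first.
  by rewrite /inc vh vt mul0r.
by rewrite {1 3}/inc !eqxx eq_sym (negPf nht) mul1r mulN1r addr0.
Qed.

Definition antisym_mx : 'M[int]_#|{: edge G}| :=
  (incidence_mx o)^T *m incidence_mx o - 2%:M.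

Lemma antisym_mxE i j :
  antisym_mx i j =
  \sum_v inc o v (enum_val i) * inc o v (enum_val j) - 2 *+ (i == j).
Proof.
rewrite !mxE; congr (_ - _).
rewrite [RHS](reindex _ (onW_bij _ (enum_val_bij V))).
by apply: eq_bigr => k _; rewrite !mxE.
Qed.

Lemma antisym_mx_sym i j : antisym_mx i j = antisym_mx j i.
Proof.
rewrite !antisym_mxE eq_sym; congr (_ - _).
by apply: eq_bigr => v _; rewrite mulrC.
Qed.

Lemma antisym_mx_diag i : antisym_mx i i = 0.
Proof.
rewrite antisym_mxE eqxx inc_sum /inc !eqxx eq_sym.
by rewrite (negPf (head_neq_tail _)).
Qed.

Lemma antisym_mx_val i j : antisym_mx i j \in [:: -1; 0; 1].
Proof.
have [<-|nij] := eqVneq i j; first by rewrite antisym_mx_diag.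
rewrite antisym_mxE (negPf nij) mulr0n subr0 inc_sum.
have : ~~ ((ehead o (enum_val i) \in val (enum_val j)) &&
           (etail o (enum_val i) \in val (enum_val j))).
  apply: contra nij => /andP[hj tj].
  apply/eqP/enum_val_inj/val_inj/eqP.
  rewrite eqEcard !card_edge leqnn andbT {1}(orientationP o) subUset.
  by rewrite !sub1set hj tj.
rewrite -!inc_neq0 /inc.
by repeat case: ifP => _.
Qed.

Definition antisym_line_graph : signed_graph #|{: edge G}| :=
  SignedGraph antisym_mx_sym antisym_mx_diag antisym_mx_val.

End AntisymmetricLineGraph.

(* Main.v *)
(** Switch each edge of [G], as a vertex of the line graph, so that it leaves
    every endpoint in [A] and enters every endpoint in [B].  This is possible for
    the edges crossing the cut; a defect edge [f] can only be made to do so at one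
    endpoint, and we let the other one, [wrong f], be an endpoint of minimal
    degree.  Two edges meeting at [v] are then joined by a negative edge only if
    [v] is the wrong endpoint of exactly one of them, so each defect edge [f] is
    responsible for at most [degree (wrong f) - 1] negative edges, and deleting
    the edges that are negative after switching balances the line graph. *)
Require Import Defs.
From mathcomp Require Import all_boot all_order all_algebra.

Import GRing.Theory.

Lemma perm_map_next (T : eqType) (c : seq T) :
  uniq c -> perm_eq (map (next c) c) c.
Proof.
move=> Uc.
have Un : uniq (map (next c) c) by rewrite (map_inj_uniq (can_inj (prev_next Uc))).
have sub : {subset map (next c) c <= c}.
  by move=> _ /mapP[x cx ->]; rewrite mem_next.
have [_ eqc] := uniq_min_size Un sub (eq_leq (esym (size_map _ _))).
by apply: uniq_perm => // x; rewrite eqc.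
Qed.

Definition switched_negative {n : nat} (S : signed_graph n) (s : 'I_n -> int) :
    {set {set 'I_n}} :=
  [set [set p.1; p.2] | p : 'I_n * 'I_n & (S p.1 p.2 * (s p.1 * s p.2) == -1)%R].

(** Every surviving edge [i j] is positive after switching, so its sign in [S] is [s i * s j].
    Around a cycle each vertex then contributes its [s] twice, and the sign is 1. *)
Lemma frustration_set_switched_negative (n : nat) (S : signed_graph n)
    (s : 'I_n -> int) (s2 : forall i, (s i * s i = 1)%R) :
  frustration_set S (switched_negative S s).
Proof.
apply/andP; split.
  apply/subsetP => _ /imsetP[p + ->]; rewrite inE => Np.
  apply/imsetP; exists p => //; rewrite inE /=.
  by apply: contraTneq Np => ->; rewrite mul0r.
apply/balancedP => c /and3P[_ Uc Cc].
have signE i : i \in c ->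
    delete_edges S (switched_negative S s) i (next c i) = (s i * s (next c i))%R.
  move=> ci; have /= := next_cycle Cc ci; set j := next c i; rewrite !mxE.
  case: ifPn => [_|nF Sij]; first by rewrite eqxx.
  have {nF} : (S i j * (s i * s j) != -1)%R.
    by apply: contra nF => Nij; apply/imsetP; exists (i, j); rewrite ?inE.
  have s1 k : s k = 1%R \/ s k = (-1)%R.
    by have /eqP := s2 k; rewrite -expr2 sqrf_eq1 => /orP[]/eqP; [left|right].
  have := sadj_val S i j; rewrite !inE (negPf Sij) /=.
  by case: (s1 i) => ->; case: (s1 j) => -> /orP[]/eqP ->.
rewrite /cycle_sign (eq_big_seq _ signE) big_split /=.
(* Since [next c] permutes the cycle, the product of [s (next c i)] is the product of [s i]. *)
rewrite -(big_map (next c) xpredT s) /= (perm_big _ (perm_map_next _ _ Uc)) /=.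
by rewrite -big_split big1 // => i _; exact: s2.
Qed.

Lemma cut_defect_partition (V : finType) (G : sgraph V) (A B : {set V}) :
  bipartition A B ->
  #|edge_set G| = #|cut_edges G A B| + #|defect_edges G A B|.
Proof.
case/andP => /eqP AB dAB.
have inAB v : (v \in B) = (v \notin A).
  have := in_setT v; rewrite -AB inE.
  by case: (boolP (v \in A)) => [/(disjointFr dAB)->|].
rewrite -(cardsID (cut_edges G A B) (edge_set G)); congr (_ + _).
  by apply: eq_card => f; rewrite !inE andbA andbb.
apply: eq_card => f; rewrite !inE andbC; apply: andb_id2l => Ef; rewrite Ef /=.
case/imsetP: Ef => -[x y] _ -> /=.
rewrite !subUset !sub1set !inAB.
apply/idP/idP => [|same].
  apply: contraR; rewrite negb_or !negb_and !negbK.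
  case/andP => /orP[xA|yA] /orP[xA'|yA'].
  - by rewrite xA' in xA.
  - apply/exists_inP; exists y => //; apply/exists_inP; exists x.
      by rewrite inAB.
    by rewrite setUC.
  - apply/exists_inP; exists x => //; apply/exists_inP; exists y => //.
    by rewrite inAB.
  - by rewrite yA' in yA.
apply/exists_inP => -[a aA /exists_inP[b bB /eqP E]].
have : a \in [set x; y] by rewrite E !inE eqxx.
have : b \in [set x; y] by rewrite E !inE eqxx orbT.
rewrite !inE inAB in bB *.
by case/orP => /eqP bE /orP[]/eqP aE; subst a b; move: same aA bB;
  do 2?case: (_ \in A).
Qed.

Lemma card_edges_at (V : finType) (G : sgraph V) (v : V) :
  #|[set f : edge G | v \in val f]| <= degree G v.
Proof.
rewrite -(card_imset _ val_inj) /degree.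
apply: leq_trans (leq_imset_card (fun w => [set v; w]) _).
apply/subset_leq_card/subsetP => _ /imsetP[f + ->]; rewrite inE.
case/imsetP: (valP f) => -[x y]; rewrite inE /= => xy ->.
rewrite !inE => /orP[]/eqP ->.
  by apply/imsetP; exists y; rewrite ?inE.
by apply/imsetP; exists x; rewrite ?inE 1?adj_sym // setUC.
Qed.

(** Only common endpoints contribute to the inner product of two columns, and distinct edges of a
    simple graph share at most one vertex, so a single term survives. *)
Lemma antisym_mx_common (V : finType) (G : sgraph V) (o : orientation G) i j :
  (antisym_mx o i j != 0)%R ->
  exists v, [/\ v \in val (enum_val i), v \in val (enum_val j) &
    antisym_mx o i j = (inc o v (enum_val i) * inc o v (enum_val j))%R].
Proof.
have [<-|nij] := eqVneq i j; first by rewrite antisym_mx_diag eqxx.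
rewrite antisym_mxE (negPf nij) mulr0n subr0.
set f := enum_val i; set g := enum_val j => nz.
have nfg : f != g by rewrite (inj_eq enum_val_inj).
have [v vf vg] : exists2 v, v \in val f & v \in val g.
  case: (pickP (fun v => (v \in val f) && (v \in val g))) => [v /andP[]|no].
    by exists v.
  case/eqP: nz; apply: big1 => v _; apply/eqP; rewrite mulf_eq0.
  have := no v; rewrite -!(inc_neq0 o).
  by case: (_ == _); case: (_ == _).
exists v; split=> //; rewrite (bigD1 v) //= big1 ?addr0 // => w wv.
apply/eqP; rewrite mulf_eq0 -[_ || _]negbK negb_or !inc_neq0.
apply: contra nfg => /andP[wf wg].
have pairE (h : edge G) : v \in val h -> w \in val h -> val h = [set v; w].
  move=> vh wh; apply/esym/eqP; rewrite eqEcard card_edge cards2 eq_sym wv andbT.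
  by rewrite subUset !sub1set vh wh.
by apply/eqP/val_inj; exact: etrans (pairE f vf wf) (esym (pairE g vg wg)).
Qed.

Theorem theorem8 (V : finType) (G : sgraph V) (o : orientation G)
    (A B : {set V}) (hAB : maximum_cut G A B) :
  [/\ #|defect_edges G A B| = maxcut_defect G,
      frustration_index (antisym_line_graph o) <=
        \sum_(f : edge G | val f \in defect_edges G A B)
           minn (degree G (etail o f) - 1) (degree G (ehead o f) - 1)
    & frustration_index (antisym_line_graph o) <=
        (max_degree G - 1) * maxcut_defect G].
Proof.
have [bAB cutE] := hAB.
have defE : #|defect_edges G A B| = maxcut_defect G.
  by rewrite /maxcut_defect (cut_defect_partition _ _ _ _ bAB) cutE addKn.
set D := defect_edges G A B in defE *.
set S := antisym_line_graph o.
(* The bound by maximum degree follows: each minimum is at most [max_degree G - 1], and there is one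
   term per defect edge. *)
suff bound : frustration_index S <= \sum_(f : edge G | val f \in D)
    minn (degree G (etail o f) - 1) (degree G (ehead o f) - 1).
  split=> //; apply: leq_trans bound _.
  have -> : maxcut_defect G = #|[set f : edge G | val f \in D]|.
    rewrite -defE -[RHS](card_imset _ val_inj); apply: eq_card => f.
    apply/idP/imsetP => [fD|[g + ->]]; last by rewrite inE.
    have fE : f \in edge_set G by move: fD; rewrite inE => /andP[].
    exists (exist _ f fE) => [|//]; rewrite in_set; exact: fD.
  rewrite mulnC -sum_nat_const; under [X in _ <= X]eq_bigl do rewrite inE.
  apply: leq_sum => f _; rewrite (leq_trans (geq_minl _ _)) // leq_sub2r //.
  exact: leq_bigmax.
pose tail_wrong f := degree G (etail o f) <= degree G (ehead o f).
pose wrong f := if tail_wrong f then etail o f else ehead o f.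
pose right f := if tail_wrong f then ehead o f else etail o f.
have wrongE f : degree G (wrong f) - 1 =
    minn (degree G (etail o f) - 1) (degree G (ehead o f) - 1).
  rewrite /wrong /tail_wrong; case: ifP => [le|/negbT]; last rewrite -ltnNge => /ltnW le.
    by apply/esym/minn_idPl; rewrite leq_sub2r.
  by apply/esym/minn_idPr; rewrite leq_sub2r.
(* The incidence sign wanted at [v] after switching: edges enter vertices of [B] and leave all
   others. The factor [sw f] enforces it at [right f], where the incidence is 1 or -1. *)
pose eps v : int := (if v \in B then 1 else -1)%R.
pose sw f : int := (eps (right f) * inc o (right f) f)%R.
have eps2 v : (eps v * eps v = 1)%R by rewrite /eps; case: ifP.
have sw2 f : (sw f * sw f = 1)%R.
  have nht := head_neq_tail o f.
  rewrite /sw mulrACA eps2 /right; case: ifP => _; rewrite /inc ?eqxx //.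
  by rewrite eq_sym (negPf nht).
(* At [right f] this is the choice of [sw]. If [f] crosses the cut, both [inc] and [eps] change sign
   between its endpoints, so it also holds at [wrong f]. *)
have aligned v (f : edge G) : v \in val f -> (v != wrong f) || (val f \notin D) ->
    (inc o v f * sw f = eps v)%R.
  have [/eqP AB dAB] := andP bAB.
  have inAB u : (u \in A) = (u \notin B).
    have := in_setT u; rewrite -AB inE.
    by case: (boolP (u \in B)) => [/(disjointFl dAB)->|]; rewrite ?orbF.
  have nht := head_neq_tail o f.
  rewrite /D inE (valP f) (orientationP o) /= !subUset !sub1set !inAB !inE.
  rewrite /sw /right /wrong /eps /inc.
  by case: (tail_wrong f) => /orP[]/eqP ->;
    rewrite ?eqxx ?(negPf nht) 1?eq_sym ?(negPf nht) ?eqxx //=;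
    case: (_ \in B); case: (_ \in B).
have [_ /(_ _ (frustration_set_switched_negative _ S (sw \o enum_val) _)) le] :=
  frustration_indexP S.
apply: leq_trans (le (fun i => sw2 _)) _ => {le}.
(* [P f] collects the pairs charged to [f]: those joining it to another edge through [wrong f]. *)
pose N f := [set g : edge G | wrong f \in val g] :\ f.
pose P f := [set [set enum_rank f; enum_rank g] | g in N f].
have cardP f : #|P f| <= degree G (wrong f) - 1.
  have wf : wrong f \in val f.
    by rewrite (orientationP o) /wrong; case: ifP; rewrite !inE eqxx ?orbT.
  apply: leq_trans (leq_imset_card _ _) _.
  (* The edge [f] is itself incident to [wrong f]; leaving it out accounts for the [- 1]. *)
  have := card_edges_at _ G (wrong f); rewrite (cardsD1 f) [f \in _]in_set wf.
  by case: (degree G (wrong f)) => // d; rewrite subn1.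
apply: (@leq_trans #|\bigcup_(f : edge G | val f \in D) P f|); last first.
  apply: (@leq_trans (\sum_(f : edge G | val f \in D) #|P f|)).
    elim/big_rec2: _ => [|f m X _ le]; first by rewrite cards0.
    by rewrite (leq_trans (leq_card_setU _ _)) // leq_add2l.
  by apply: leq_sum => f _; rewrite -wrongE.
apply/subset_leq_card/subsetP => _ /imsetP[[i j] + ->] /=; rewrite inE /= => neg.
have nz : antisym_mx o i j != 0%R by apply: contraTneq neg => ->; rewrite mul0r.
have nij : i != j by apply: contraNneq nz => ->; rewrite antisym_mx_diag.
have [v [vi vj Eij]] := antisym_mx_common _ _ _ _ _ nz.
(* Stated for an ordered pair, so that either of the two edges meeting at [v] can take the
   charge. *)
have inP (k l : 'I_#|{: edge G}|) :
    v \in val (enum_val k) -> v \in val (enum_val l) -> k != l ->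
    v = wrong (enum_val k) -> val (enum_val k) \in D ->
    [set k; l] \in \bigcup_(f : edge G | val f \in D) P f.
  move=> vk vl nkl vE kD; apply/bigcupP; exists (enum_val k) => //.
  apply/imsetP; exists (enum_val l); last by rewrite !enum_valK.
  by rewrite !inE -vE vl (inj_eq enum_val_inj) eq_sym nkl.
have [/andP[/eqP vw iD]|okI] :=
  boolP ((v == wrong (enum_val i)) && (val (enum_val i) \in D)).
  exact: inP.
have [/andP[/eqP vw jD]|okJ] :=
  boolP ((v == wrong (enum_val j)) && (val (enum_val j) \in D)).
  by rewrite setUC; apply: inP; rewrite // eq_sym.
(* Now both edges are aligned at [v], so the switched sign is [eps v * eps v = 1], contradicting
   [neg]. *)
rewrite !negb_and in okI okJ.
by move: neg; rewrite Eij mulrACA !aligned // eps2.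
Qed.
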